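(* Let $(X,d)$ be a uniformly coarsely proper visual Gromov hyperbolic metric space whose Gromov boundary $\partial X$ is a finite union of uniformly coarsely connected components, each containing at least two points. Then $(X,d)$ is non-amenable.
   Context: Gromov hyperbolic: with the Gromov product $(x|y)_w=\frac12(d(x,w)+d(y,w)-d(x,y))$, $(X,d)$ is Gromov hyperbolic if for some $\delta\in[0,\infty)$ one has $(x|z)_w\ge\min\{(x|y)_w,(y|z)_w\}-\delta$ for all $x,y,z,w\in X$. No geodesicity or properness is assumed. Visual: a $\mu$-roughly geodesic ray issuing from $\gamma(0)$ is a map $\gamma\colon[0,\infty)\to X$ with $|s-t|-\mu\le d(\gamma(s),\gamma(t))\le|s-t|+\mu$ for all $s,t$. The space $(X,d)$ is visual if there exist $\mu\ge 0$ and $o\in X$ such that every point of $X$ lies in the image of some $\mu$-roughly geodesic ray issuing from $o$. Gromov boundary: $\partial X$ is the set of equivalence classes of sequences $(x_i)$ in $X$ with $(x_i|x_j)_o\to\infty$ as $i,j\to\infty$, where $(x_i)\sim(y_i)$ if $(x_i|y_i)_o\to\infty$. It is a bounded metric space when equipped with a visual metric, i.e. a metric $d_\varepsilon$ for which there are $\varepsilon>0$ and $c\ge1$ with $c^{-1}e^{-\varepsilon(a|b)_o}\le d_\varepsilon(a,b)\le c\,e^{-\varepsilon(a|b)_o}$ for all $a,b\in\partial X$, where $(a|b)_o=\sup\liminf_{i,j\to\infty}(x_i|y_j)_o$ (supremum over representatives $(x_i)$ of $a$ and $(y_j)$ of $b$) and $e^{-\infty}=0$. Such a metric exists for all sufficiently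 small $\varepsilon>0$, and the uniformly coarsely connected components of $\partial X$ do not depend on the choice of visual metric. Write $B(x,r)=\{y: d(x,y)<r\}$ for open balls. Uniformly coarsely proper: $(X,d)$ is uniformly coarsely proper if there exist $N\colon(0,\infty)\times(0,\infty)\to\mathbb{N}$ and $r_b>0$ such that for all $R>r>r_b$ every open ball of radius $R$ in $X$ can be covered by $N(R,r)$ open balls of radius $r$ in $X$. Quasi-lattice: a subset $\Gamma\subseteq X$ which is cobounded (there is $\mu>0$ with $d(x,\Gamma)<\mu$ for all $x\in X$) and uniformly locally finite (there is $N\colon(0,\infty)\to\mathbb{N}$ with $\#(\Gamma\cap B(x,r))\le N(r)$ for all $0<r<\infty$ and all $x\in X$). Non-amenable: a uniformly coarsely proper space $(X,d)$ is non-amenable if there exist a quasi-lattice $\Gamma\subseteq X$ and constants $C>0$, $r>0$ such that every finite subset $F\subseteq\Gamma$ satisfies $\#F\le C\,\#\partial_rF$, where $\partial_rF=\{x\in\Gamma: d(x,F)<r \text{ and } d(x,\Gamma\setminus F)<r\}$. Coarse connectedness: for $\varepsilon>0$, a metric space $(Y,d)$ is $\varepsilon$-coarsely connected if for all $x,y\in Y$ there is a finite sequence $x=x_0,\dots,x_n=y$ in $Y$ with $d(x_i,x_{i+1})\le\varepsilon$ for all $0\le i\le n-1$. It is uniformly coarsely connected if it is $\varepsilon$-coarsely connected for all $\varepsilon>0$. A uniformly coarsely connected component of $(Y,d)$ is a subset of the form $C(x,Y)=\bigcup\{A: x\in A\subseteq Y,\ A \text{ uniformly coarsely connected}\}$ with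 $x\in Y$ (subsets carry the restricted metric). *)

(* Defs.v *)
From HB Require Import structures.
From mathcomp Require Import all_boot all_order all_algebra finmap.
From mathcomp Require Import all_classical all_reals all_analysis.

Set Implicit Arguments.
Unset Strict Implicit.
Unset Printing Implicit Defensive.

Import Order.TTheory GRing.Theory Num.Theory.
Import numFieldNormedType.Exports.

Local Open Scope classical_set_scope.
Local Open Scope ring_scope.

Section MetricSpace.
Context {R : realType}.
Variable X : metricType R.
Implicit Types (x y w o : X) (u v : nat -> X) (F Gamma : set X).

Definition gromov_product w x y : R :=
  (mdist x w + mdist y w - mdist x y) / 2.

Definition gromov_hyperbolic : Prop :=
  exists2 delta : R, 0 <= delta &
    forall x y z w : X,
      Num.min (gromov_product w x y) (gromov_product w y z) - delta
        <= gromov_product w x z.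

(* gamma is total on R, but only its values on [0, +oo[ are relevant. *)
Definition roughly_geodesic_ray (mu : R) (gamma : R -> X) : Prop :=
  forall s t : R, 0 <= s -> 0 <= t ->
    `|s - t| - mu <= mdist (gamma s) (gamma t) <= `|s - t| + mu.

Definition visual : Prop :=
  exists (mu : R) (o : X), 0 <= mu /\
    forall x, exists gamma : R -> X,
      [/\ roughly_geodesic_ray mu gamma, gamma 0 = o &
          exists2 t : R, 0 <= t & gamma t = x].

(* [ball x r] is the open ball [set y | mdist x y < r], see ballEmdist. *)
Definition uniformly_coarsely_proper : Prop :=
  exists (N : R -> R -> nat) (rb : R), 0 < rb /\
    forall r1 r2 : R, rb < r2 -> r2 < r1 ->
    forall x, exists c : 'I_(N r1 r2) -> X,
      ball x r1 `<=` \bigcup_i ball (c i) r2.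

(* The infimum is taken in \bar R, so that d(x, set0) = +oo. *)
Definition dist_to_set x (A : set X) : \bar R :=
  ereal_inf [set (mdist x a)%:E | a in A].

Definition cobounded Gamma : Prop :=
  exists2 mu : R, 0 < mu & forall x, (dist_to_set x Gamma < mu%:E)%E.

Definition uniformly_locally_finite Gamma : Prop :=
  exists N : R -> nat, forall (r : R) x, 0 < r ->
    (Gamma `&` ball x r #<= `I_(N r))%card.

Definition quasi_lattice Gamma : Prop :=
  cobounded Gamma /\ uniformly_locally_finite Gamma.

Definition r_boundary Gamma (r : R) F : set X :=
  [set x | [/\ Gamma x, (dist_to_set x F < r%:E)%E &
               (dist_to_set x (Gamma `\` F) < r%:E)%E]].

(* #|` fset_set A| is the cardinality of A when A is finite; r_boundary Gamma
   r F is finite for F finite, as Gamma is uniformly locally finite. *)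
Definition non_amenable : Prop :=
  exists (Gamma : set X) (C r : R),
    [/\ quasi_lattice Gamma, 0 < C, 0 < r &
        forall F, F `<=` Gamma -> finite_set F ->
          (#|` fset_set F|)%:R <= C * (#|` fset_set (r_boundary Gamma r F)|)%:R].

Definition converges_to_infinity o u : Prop :=
  gromov_product o (u ij.1) (u ij.2) @[ij --> (\oo, \oo)] --> +oo.

Definition equivalent_at_infinity o u v : Prop :=
  gromov_product o (u i) (v i) @[i --> \oo] --> +oo.

Definition class_at_infinity o u : set (nat -> X) :=
  [set v | converges_to_infinity o v /\ equivalent_at_infinity o u v].

(* A point of the boundary is literally an equivalence class, i.e. a set of
   sequences. *)
Definition gromov_boundary o : set (set (nat -> X)) :=
  [set class_at_infinity o u | u in [set u | converges_to_infinity o u]].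

Definition boundary_product o (a b : set (nat -> X)) : \bar R :=
  ereal_sup [set l | exists u v, [/\ a u, b v &
    l = limf_einf (fun ij : nat * nat =>
                     (gromov_product o (u ij.1) (v ij.2))%:E) (filter_prod \oo \oo)]].

End MetricSpace.

(* A metric space (Y, d) is given by a set Y in an ambient type T and a function
   d on T of which only the restriction to Y matters; a subset A of Y then
   carries the restricted metric with the same d. *)
Section CoarseConnectedness.
Context {R : realType} {T : Type}.
Variable d : T -> T -> R.
Implicit Types (A Y : set T).

Definition metric_on Y : Prop :=
  [/\ forall x y, Y x -> Y y -> 0 <= d x y,
      forall x y, Y x -> Y y -> (d x y = 0 <-> x = y),
      forall x y, Y x -> Y y -> d x y = d y x &
      forall x y z, Y x -> Y y -> Y z -> d x z <= d x y + d y z].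

Definition coarsely_connected (eps : R) A : Prop :=
  forall x y, A x -> A y -> exists (n : nat) (p : nat -> T),
    [/\ p 0%N = x, p n = y,
        forall i, (i <= n)%N -> A (p i) &
        forall i, (i < n)%N -> d (p i) (p i.+1) <= eps].

Definition uniformly_coarsely_connected A : Prop :=
  forall eps : R, 0 < eps -> coarsely_connected eps A.

Definition ucc_component Y (x : T) : set T :=
  \bigcup_(A in [set A | [/\ A x, A `<=` Y & uniformly_coarsely_connected A]]) A.

Definition finite_union_of_nontrivial_ucc_components Y : Prop :=
  exists K : set (set T),
    [/\ finite_set K,
        K `<=` [set ucc_component Y x | x in Y],
        forall A, K A -> exists a b, [/\ A a, A b & a <> b] &
        Y = \bigcup_(A in K) A].

End CoarseConnectedness.

(* expeR -oo = 0 *)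
Definition visual_metric {R : realType} (X : metricType R) (o : X)
    (d : set (nat -> X) -> set (nat -> X) -> R) : Prop :=
  metric_on d (gromov_boundary o) /\
  exists eps c : R, [/\ 0 < eps, 1 <= c &
    forall a b, gromov_boundary o a -> gromov_boundary o b ->
      ((c^-1)%:E * expeR (- (eps%:E * boundary_product o a b))
         <= (d a b)%:E <=
       c%:E * expeR (- (eps%:E * boundary_product o a b)))%E].

(* Main.v *)
Require Import Defs.
From mathcomp Require Import all_boot all_order all_algebra finmap.
From mathcomp Require Import all_classical all_reals all_analysis.
From mathcomp Require Import lra zify.

(** Let [Gamma] be a maximal [rho]-separated set, and call [y] a descendant of [x]
    if [y] lies about [L] further from [o] than [x] and [x] lies within bounded
    distance of a geodesic from [o] to [y], i.e. [(x|y)_o >= d(x,o) - c].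
    By hyperbolicity the ancestors of a point lie in a ball whose radius depends
    on [c] and [delta] but not on [L], so there are at most [N] of them in
    [Gamma].  On the other hand [x] lies on a rough ray towards some [xi] in the
    boundary; a fine chain leaving [xi] inside its component meets [M] spheres
    about [xi] of equidistant radii, all comparable to [exp(- eps d(x,o))].
    Rough rays towards these [M] boundary points stay close to [x] up to distance
    [d(x,o)] and are far apart at distance [d(x,o) + L] if [L] is large, so that
    [x] has [M] descendants in [Gamma].  With [M = 2 N], double counting shows
    that every finite [F] in [Gamma] has a neighbourhood of at least [2 #F]
    points. *)

Set Implicit Arguments.
Unset Strict Implicit.
Unset Printing Implicit Defensive.

Import Order.TTheory GRing.Theory Num.Theory.
Import numFieldNormedType.Exports.

Local Open Scope classical_set_scope.
Local Open Scope ring_scope.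

(** * Limits inferior of extended real functions along a filter *)

Section LimitInferior.
Context {R : realType} {C : choiceType} {T : filteredType C}.
Variables (f : T -> \bar R) (F : set_system T).
Local Open Scope ereal_scope.

Lemma limf_einf_gt (a : \bar R) : Filter F ->
  a < limf_einf f F -> \forall x \near F, a < f x.
Proof.
move=> FF; rewrite /limf_einf lteNr => /ereal_inf_lt[_ [V FV <-]] sup_lt.
apply: filterS FV => x Vx; rewrite -lteN2; apply: le_lt_trans sup_lt.
by apply: ereal_sup_ubound; exists x.
Qed.

Lemma limf_einf_lt (a : \bar R) (P : set T) :
  limf_einf f F < a -> F P -> exists2 x, P x & f x < a.
Proof.
move=> lima FP; apply: contrapT => nex.
move: lima; rewrite ltNge => /negP; apply.
rewrite /limf_einf leeNr; apply: (@le_trans _ _ (ereal_sup ((\- f) @` P))).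
  by apply: ereal_inf_lbound; exists P.
apply: ge_ereal_sup => _ [x Px <-]; rewrite leeN2 leNgt; apply/negP => fxa.
by apply: nex; exists x.
Qed.
End LimitInferior.

(** * Sequences going to infinity, in terms of explicit thresholds *)

Lemma converges_to_infinityP (R : realType) (X : metricType R) (o : X) u :
  converges_to_infinity o u <->
  forall A : R, exists n, forall i j, (n <= i)%N -> (n <= j)%N ->
    A <= gromov_product o (u i) (u j).
Proof.
rewrite /converges_to_infinity; split.
  move/cvgryPge => h A; have [[P Q] /= [[n _ nP] [m _ mQ]] PQ] := h A.
  exists (maxn n m) => i j; rewrite !geq_max => /andP[ni mi] /andP[nj mj].
  by apply: (PQ (i, j)); split; [exact: nP|exact: mQ].
move=> h; apply/cvgryPge => A; have [n hn] := h A.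
exists ([set i | (n <= i)%N], [set i | (n <= i)%N]) => /=.
  by split; exists n.
by move=> [i j] [/= ni nj]; exact: hn.
Qed.

Lemma equivalent_at_infinityP (R : realType) (X : metricType R) (o : X) u v :
  equivalent_at_infinity o u v <->
  forall A : R, exists n, forall i, (n <= i)%N ->
    A <= gromov_product o (u i) (v i).
Proof.
rewrite /equivalent_at_infinity; split.
  by move/cvgryPge => h A; have [n _ nP] := h A; exists n => i /nP.
move=> h; apply/cvgryPge => A; have [n hn] := h A.
by exists n => // i /hn.
Qed.

(** * Gromov products, in the space and on its boundary *)

Section GromovProduct.
Context {R : realType} {X : metricType R}.
Implicit Types o x y z : X.

Lemma gromov_productC o x y : gromov_product o x y = gromov_product o y x.
Proof. by rewrite /gromov_product (metric_sym x y); lra. Qed.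

Lemma gromov_productxx o x : gromov_product o x x = mdist x o.
Proof. by rewrite /gromov_product mdistxx; lra. Qed.

Lemma mdist_gromov_product o x y :
  mdist x y = mdist x o + mdist y o - 2 * gromov_product o x y.
Proof. by rewrite /gromov_product; lra. Qed.

Lemma gromov_product_lipschitz o x y z :
  gromov_product o x y <= gromov_product o x z + mdist y z.
Proof.
rewrite /gromov_product.
have := metric_triangle x y z; have := metric_triangle y z o.
by lra.
Qed.

Lemma gromov_product_base o o' x y :
  gromov_product o' x y <= gromov_product o x y + mdist o o'.
Proof.
rewrite /gromov_product.
have := metric_triangle x o o'; have := metric_triangle y o o'.
by lra.
Qed.

Variable delta : R.
Hypothesis hyp : forall x y z w : X,
  Num.min (gromov_product w x y) (gromov_product w y z) - delta
    <= gromov_product w x z.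

Lemma gromov_product_chain2 o x y z (m : R) :
  m <= gromov_product o x y -> m <= gromov_product o y z ->
  m - delta <= gromov_product o x z.
Proof.
move=> xy yz; apply: le_trans (hyp x y z o).
by rewrite lerD2r le_min xy yz.
Qed.

Hypothesis delta0 : 0 <= delta.

Lemma gromov_product_chain3 o x y z t (m : R) :
  m <= gromov_product o x y -> m <= gromov_product o y z ->
  m <= gromov_product o z t -> m - 2 * delta <= gromov_product o x t.
Proof.
move=> xy yz zt; have xz := gromov_product_chain2 xy yz.
have zt' : m - delta <= gromov_product o z t by move: delta0 zt; lra.
by have := gromov_product_chain2 xz zt'; lra.
Qed.

Lemma class_at_infinity_refl o u : converges_to_infinity o u ->
  class_at_infinity o u u.
Proof.
move=> cu; split=> //; apply/equivalent_at_infinityP => A.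
have /converges_to_infinityP/(_ A)[n hn] := cu.
by exists n => i ni; exact: hn.
Qed.

(** Some representatives [u'], [v'] have limit inferior above [m - 1], since the supremum need not
    be attained. The chain [u k], [u' k], [v' k], [v k] then brings the bound back to [u] and [v] at
    the price of [2 * delta]. *)
Lemma boundary_product_ge o u v (m : R) :
  (m%:E <= boundary_product o (class_at_infinity o u) (class_at_infinity o v))%E ->
  exists n, forall k, (n <= k)%N ->
    m - 1 - 2 * delta <= gromov_product o (u k) (v k).
Proof.
move=> hm; have : ((m - 1)%:E <
    boundary_product o (class_at_infinity o u) (class_at_infinity o v))%E.
  by apply: lt_le_trans hm; rewrite lte_fin; lra.
move=> /ereal_sup_gt[_ [u' [v' [[_ uu'] [_ vv'] ->]]]].
move=> /limf_einf_gt [[P Q] /= [[n1 _ nP] [n2 _ nQ]] PQ].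
have /equivalent_at_infinityP/(_ (m - 1))[n3 h3] := uu'.
have /equivalent_at_infinityP/(_ (m - 1))[n4 h4] := vv'.
exists (maxn (maxn n1 n2) (maxn n3 n4)) => k.
rewrite !geq_max => /andP[/andP[k1 k2] /andP[k3 k4]].
apply: (@gromov_product_chain3 _ _ (u' k) (v' k)).
- exact: h3.
- apply: ltW; rewrite -lte_fin.
  by apply: (PQ (k, k)); split; [exact: nP|exact: nQ].
- by rewrite gromov_productC; exact: h4.
Qed.

(** A bound on the limit inferior along [u] and [v] only provides one pair of large indices [i], [j]
    with a small product. A large product at another large index [k] would contradict it through the
    chain [u i], [u k], [v k], [v j]. *)
Lemma boundary_product_le o u v (m : R) :
  converges_to_infinity o u -> converges_to_infinity o v ->
  (boundary_product o (class_at_infinity o u) (class_at_infinity o v) <= m%:E)%E ->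
  exists n, forall k, (n <= k)%N ->
    gromov_product o (u k) (v k) <= m + 1 + 2 * delta.
Proof.
move=> cu cv hm.
have liminf_lt : (limf_einf (fun ij : nat * nat =>
    (gromov_product o (u ij.1) (v ij.2))%:E) (filter_prod \oo \oo)
    < (m + 1)%:E)%E.
  apply: (@le_lt_trans _ _ m%:E); last by rewrite lte_fin; lra.
  apply: le_trans hm; apply: ereal_sup_ubound; exists u, v.
  by split=> //; exact: class_at_infinity_refl.
have /converges_to_infinityP/(_ (m + 1 + 2 * delta))[n1 h1] := cu.
have /converges_to_infinityP/(_ (m + 1 + 2 * delta))[n2 h2] := cv.
have near12 : (filter_prod \oo \oo) [set ij : nat * nat |
    (n1 <= ij.1)%N /\ (n2 <= ij.2)%N].
  exists ([set i | (n1 <= i)%N], [set i | (n2 <= i)%N]) => //=.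
  by split; [exists n1|exists n2].
have [[i j] /= [n1i n2j]] := limf_einf_lt liminf_lt near12.
rewrite lte_fin => uivj.
exists (maxn n1 n2) => k; rewrite geq_max => /andP[n1k n2k].
rewrite leNgt; apply/negP => /ltW uvk.
have := gromov_product_chain3 (h1 i k n1i n1k) uvk (h2 k j n2k n2j).
by lra.
Qed.

End GromovProduct.

(** * Inverting the two inequalities that define a visual metric *)

Section VisualEstimates.
Context {R : realType}.
Variables (eps c r : R) (b : \bar R).
Hypotheses (eps0 : 0 < eps) (c0 : 0 < c) (r0 : 0 < r).

Lemma visual_lower_bound :
  ((c^-1)%:E * expeR (- (eps%:E * b)) <= r%:E ->
   (- ln (c * r) / eps)%:E <= b)%E.
Proof.
case: b => [b'| |] /=.
- rewrite -EFinM lee_fin => h; rewrite lee_fin ler_pdivrMr// -lerN2 opprK.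
  rewrite [b' * _]mulrC -[leLHS]expRK ler_ln ?posrE ?expR_gt0 ?mulr_gt0//.
  by rewrite -ler_pdivrMl.
- by rewrite leey.
- by rewrite mulrNy gtr0_sg// mul1e /= mulry gtr0_sg ?invr_gt0// mul1e.
Qed.

(** Positivity of [r] excludes [b = +oo], for which the right-hand side of the hypothesis
    vanishes. *)
Lemma visual_upper_bound :
  (r%:E <= c%:E * expeR (- (eps%:E * b)) ->
   b <= (- ln (r / c) / eps)%:E)%E.
Proof.
case: b => [b'| |] /=.
- rewrite -EFinM lee_fin => h; rewrite lee_fin ler_pdivlMr// lerNr.
  rewrite [b' * _]mulrC -[leRHS]expRK ler_ln ?posrE ?expR_gt0 ?divr_gt0//.
  by rewrite ler_pdivrMr// [_ * c]mulrC.
- by rewrite mulry gtr0_sg// mul1e /= mule0 lee_fin leNgt r0.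
- by rewrite leNye.
Qed.

End VisualEstimates.

(** * Spheres and separated points in coarsely connected components *)

Section CoarseConnectedness.
Context {R : realType}.

(** At an index where [f] passes from below [s] to at least [s], the overshoot is at most one step
    [e]. *)
Lemma discrete_ivt (f : nat -> R) (n : nat) (s e : R) :
  f 0%N < s -> s <= f n -> (forall i, (i < n)%N -> f i.+1 <= f i + e) ->
  exists2 i, (i <= n)%N & s <= f i <= s + e.
Proof.
move=> f0s; elim: n => [|n IHn] sfn step; first by lra.
have [sn|ns] := leP s (f n).
  have [i ni fi] := IHn sn (fun i lt_in => step i (ltnW lt_in)).
  by exists i => //; exact: ltnW.
by exists n.+1 => //; rewrite sfn /=; have := step n (leqnn _); lra.
Qed.

Context {T : Type}.
Variables (d : T -> T -> R) (Y : set T).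
Hypothesis dY : metric_on d Y.

(** Along an [e]-chain from [y] to [z] inside [A], the distance to [x] grows by at most [e] per
    step, so it cannot jump over the shell between [s] and [s + e]. *)
Lemma ucc_sphere (A : set T) x y z (s e : R) : A `<=` Y -> Y x -> A y -> A z ->
  uniformly_coarsely_connected d A -> 0 < e -> d x y < s -> s <= d x z ->
  exists2 q, Y q & s <= d x q <= s + e.
Proof.
move=> AY Yx Ay Az cA e0 xys sxz; case: dY => _ _ _ tri.
have [n [p [p0 pn Ap step]]] := cA _ e0 y z Ay Az.
have [||i ni|i ni h] := @discrete_ivt (fun i => d x (p i)) n s e.
- by rewrite p0.
- by rewrite pn.
- have Yi : Y (p i) by apply/AY/Ap; lia.
  have Yi1 : Y (p i.+1) by apply/AY/Ap; lia.
  by have := step i ni; have := tri x (p i) (p i.+1) Yx Yi Yi1; lra.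
- by exists (p i) => //; exact/AY/Ap.
Qed.

(** This avoids proving that a component is itself connected: [x] and [a] are each joined to [x0] by
    a connected set. If [x0] is at distance at least [s] from [x], the set joining [x] to [x0] meets
    the shell; otherwise the one joining [x0] to [a] does. *)
Lemma ucc_component_sphere x0 x a (s e : R) :
  ucc_component d Y x0 x -> ucc_component d Y x0 a ->
  0 < s -> s <= d x a -> 0 < e -> exists2 q, Y q & s <= d x q <= s + e.
Proof.
move=> [A1 [A1x0 A1Y cA1] A1x] [A2 [A2x0 A2Y cA2] A2a] s0 sxa e0.
have Yx := A1Y _ A1x.
have [sx0|x0s] := leP s (d x x0); last exact: (@ucc_sphere A2 x x0 a).
apply: (@ucc_sphere A1 x x x0) => //.
by case: dY => _ /(_ x x Yx Yx)[_ ->].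
Qed.

Lemma finite_set_uniform_pos (I : Type) (K : set I) (P : I -> R -> Prop) :
  finite_set K -> (forall i r r', P i r -> r' <= r -> P i r') ->
  (forall i, K i -> exists2 r, 0 < r & P i r) ->
  exists2 r : R, 0 < r & forall i, K i -> P i r.
Proof.
move=> finK mono h.
(* Enumerating [K] needs decidable equality on [I], which is taken classically since [I] will be a
   type of sets. *)
have /(@finite_seqP {classic I})[s sK] := finK; move: h; rewrite sK => {finK sK} h.
elim: s h => [|i s IHs] h; first by exists 1.
have [|r r0 hr] := IHs; first by move=> j /= js; apply: h; rewrite /= inE js orbT.
have [|r' r'0 hr'] := h i; first by rewrite /= inE eqxx.
exists (Num.min r r'); first by rewrite lt_min r0.
move=> j; rewrite /= inE => /orP[/eqP ->|js].
  by apply: mono hr' _; rewrite ge_min lexx orbT.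
by apply: mono (hr _ js) _; rewrite ge_min lexx.
Qed.

(** Finitely many nontrivial components have diameters bounded below by a common constant. By the
    triangle inequality, every point of a component is at least half as far from one of two given
    far points. *)
Lemma ucc_component_uniform_diameter :
  finite_union_of_nontrivial_ucc_components d Y ->
  exists2 D : R, 0 < D & forall x, Y x -> exists x0 a,
    [/\ ucc_component d Y x0 x, ucc_component d Y x0 a & D <= d x a].
Proof.
move=> [K [finK KY nontriv YK]]; case: dY => ge0 sep sym tri.
have KsubY A a : K A -> A a -> Y a by move=> KA Aa; rewrite YK; exists A.
pose P (A : set T) (r : R) := exists a b, [/\ A a, A b & r <= d a b].
have [] := @finite_set_uniform_pos _ K P finK.
- by move=> A r r' [a [b [Aa Ab rab]]] r'r; exists a, b; split=> //; lra.
- move=> A KA; have [a [b [Aa Ab ab]]] := nontriv A KA.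
  exists (d a b); last by exists a, b.
  have Ya := KsubY _ _ KA Aa; have Yb := KsubY _ _ KA Ab.
  rewrite lt_neqAle ge0// andbT; apply/eqP => dab0.
  by apply: ab; apply/sep => //; rewrite dab0.
move=> D D0 hD; exists (D / 2); first by lra.
move=> x Yx; have := Yx; rewrite {1}YK => -[A KA Ax].
have [x0 Yx0 AE] := KY _ KA.
have [a [b [Aa Ab Dab]]] := hD _ KA.
have Ya := KsubY _ _ KA Aa; have Yb := KsubY _ _ KA Ab.
have := tri a x b Ya Yx Yb; rewrite (sym a x)// => tr.
rewrite -AE in Ax Aa Ab.
have [h|h] := leP (D / 2) (d x a); first by exists x0, a.
by exists x0, b; split=> //; lra.
Qed.

(** The points lie in shells about [x] with inner radii [h], [2 * h], ..., [M * h = s] and thickness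
    [h / 2], where [h = s / M]; consecutive shells are thus [h / 2] apart. *)
Lemma ucc_separated_points :
  finite_union_of_nontrivial_ucc_components d Y ->
  exists2 D : R, 0 < D & forall x (s : R) (M : nat), Y x -> 0 < s <= D -> (0 < M)%N ->
    exists q : 'I_M -> T,
      [/\ forall j, Y (q j), forall j, d x (q j) <= 2 * s &
          forall i j, i <> j -> s / M%:R / 2 <= d (q i) (q j)].
Proof.
move=> /ucc_component_uniform_diameter[D D0 hD]; exists D => // x s M Yx.
move=> /andP[s0 sD] M0; have [x0 [a [Cx Ca Da]]] := hD x Yx.
set h := s / M%:R.
have M0' : 0 < M%:R :> R by rewrite ltr0n.
have h0 : 0 < h by rewrite divr_gt0.
have hM : M%:R * h = s by rewrite /h mulrC divfK// gt_eqF.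
have lvl (j : 'I_M) : j.+1%:R * h <= s.
  by rewrite -hM ler_pM2r// ler_nat ltn_ord.
have /choice[q hq] : forall j : 'I_M, exists q, Y q /\
    j.+1%:R * h <= d x q <= j.+1%:R * h + h / 2.
  move=> j; have [|||||q Yq hq] := @ucc_component_sphere x0 x a (j.+1%:R * h) (h / 2).
  - exact: Cx.
  - exact: Ca.
  - by rewrite mulr_gt0// ltr0n.
  - by have := lvl j; lra.
  - by lra.
  - by exists q.
have hs : h <= s by rewrite -hM ler_peMl ?ler1n// ltW.
case: dY => ge0 sep sym tri.
have Yq j : Y (q j) by case: (hq j).
exists q; split=> //.
  by move=> j; have [_ /andP[_]] := hq j; have := lvl j; lra.
have aux (i j : 'I_M) : (i < j)%N -> h / 2 <= d (q i) (q j).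
  move=> ij; have [_ /andP[_ hi]] := hq i; have [_ /andP[hj _]] := hq j.
  have : i.+1%:R * h + h <= j.+1%:R * h.
    by rewrite -[X in _ + X]mul1r -mulrDl ler_pM2r// natr1 ler_nat; lia.
  by have := tri x (q i) (q j) Yx (Yq i) (Yq j); lra.
move=> i j ij; have [lt|lt|eq] := ltngtP i j; first exact: aux.
  by rewrite sym//; exact: aux.
by case: ij; exact: val_inj.
Qed.

End CoarseConnectedness.

(** * Counting in finite sequences *)

Lemma double_counting (T U : eqType) (s : seq T) (t : seq U)
    (P : T -> U -> bool) (M N : nat) :
  (forall x, x \in s -> M <= count (P x) t)%N ->
  (forall y, y \in t -> count (P^~ y) s <= N)%N ->
  (M * size s <= N * size t)%N.
Proof.
move=> hM hN.
apply: (@leq_trans (\sum_(x <- s) \sum_(y <- t) P x y)%N).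
  rewrite mulnC -sum1_size big_distrl /= big_seq [X in (_ <= X)%N]big_seq.
  by apply: leq_sum => x /hM; rewrite mul1n -sum1_count big_mkcond.
rewrite exchange_big /= mulnC -sum1_size big_distrl /= big_seq [X in (_ <= X)%N]big_seq.
by apply: leq_sum => y /hN; rewrite mul1n -sum1_count big_mkcond.
Qed.

Lemma card_le_seq (T : choiceType) (A : set T) (n : nat) (s : seq T) :
  (A #<= `I_n)%card -> uniq s -> (forall x, x \in s -> A x) -> (size s <= n)%N.
Proof.
move=> An us sA.
have finA : finite_set A by apply/finite_set_leP; exists n.
apply: leq_trans (geq_card_fset_set An).
apply: uniq_leq_size => // x xs.
by rewrite in_fset_set// inE; exact: sA.
Qed.

(** * Separated nets, and non-amenability from an expanding relation *)

Section QuasiLattices.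
Context {R : realType} {X : metricType R}.
Implicit Types Gamma : set X.

Lemma dist_to_set_lt (x : X) (A : set X) (r : R) :
  (dist_to_set x A < r%:E)%E <-> exists2 a, A a & mdist x a < r.
Proof.
split=> [/ereal_inf_lt[_ [a Aa <-]]|[a Aa xa]].
  by rewrite lte_fin => ?; exists a.
apply: (@le_lt_trans _ _ (mdist x a)%:E); last by rewrite lte_fin.
by apply: ereal_inf_lbound; exists a.
Qed.

Lemma maximal_separated_set (rho : R) : 0 < rho -> exists Gamma,
  (forall x y, Gamma x -> Gamma y -> x <> y -> rho <= mdist x y) /\
  (forall x, exists2 g, Gamma g & mdist x g < rho).
Proof.
move=> rho0.
pose P := [set G : set X | forall x y, G x -> G y -> x <> y -> rho <= mdist x y].
have [F FP totF|G [PG maxG]] := @Zorn_bigcup X P.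
  move=> x y [A FA Ax] [B FB By].
  have [AB|BA] := totF _ _ FA FB.
    by apply: (FP _ FB) => //; exact: AB.
  by apply: (FP _ FA) => //; exact: BA.
exists G; split=> // x; apply: contrapT => far.
have farG g : G g -> rho <= mdist x g.
  by move=> Gg; rewrite leNgt; apply/negP => xg; apply: far; exists g.
have nGx : ~ G x by move=> Gx; apply: far; exists x; rewrite ?mdistxx.
apply: (maxG (G `|` [set x])).
  by split=> [y Gy|/(_ x (or_intror erefl))//]; left.
move=> y z [Gy|->] [Gz|->] yz //; first exact: PG.
  by rewrite metric_sym; exact: farG.
exact: farG.
Qed.

(** With [rho = 2 * (rb + 1)], an open ball of radius [rb + 1] contains at most one point of a
    [rho]-separated set, so counting the covering balls bounds the number of points. *)
Lemma separated_uniformly_locally_finite :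
  uniformly_coarsely_proper X -> exists2 rho : R, 0 < rho &
  forall Gamma,
    (forall x y, Gamma x -> Gamma y -> x <> y -> rho <= mdist x y) ->
    uniformly_locally_finite Gamma.
Proof.
move=> [N [rb [rb0 cover]]]; exists (2 * (rb + 1)); first by lra.
(* The maximum makes the large radius exceed [rb + 1], as the covering property requires, even when
   [r] is small. *)
move=> Gamma sepG; exists (fun r => N (Num.max r (rb + 2)) (rb + 1)) => r x r0.
have [||c hc] := cover (Num.max r (rb + 2)) (rb + 1) _ _ x; [lra| |].
  by rewrite lt_max; apply/orP; right; lra.
have /choice[f hf] : forall y, exists i : nat, (Gamma `&` ball x r) y ->
    exists2 j : 'I_(N (Num.max r (rb + 2)) (rb + 1)),
      i = j & ball (c j) (rb + 1) y.
  move=> y; have [[Gy xy]|ny] := pselect ((Gamma `&` ball x r) y); last by exists 0%N.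
  have [|j _ cjy] := hc y; last by exists j => _; exists j.
  by apply: le_ball xy; rewrite le_max lexx.
have injf : {in Gamma `&` ball x r &, injective f}.
  move=> y z; rewrite !inE => Gy Gz fyz.
  have [i fi] := hf _ Gy; have [j fj] := hf _ Gz.
  have -> : j = i by apply: val_inj; rewrite /= -fi -fj fyz.
  rewrite !ballEmdist /= => ciz ciy; apply: contrapT => yz.
  have := sepG y z Gy.1 Gz.1 yz; have := metric_triangle y (c i) z.
  by rewrite (metric_sym y (c i)); lra.
rewrite -(card_le_eql (inj_card_eq injf)); apply: subset_card_le.
by move=> _ [y /hf[j -> _] <-] /=.
Qed.

(* C = 1 works: each of the 2 N #F pairs (x, y) with x in F has y in the
   r-neighbourhood of F, which has thus at least 2 #F elements. *)
Lemma expanding_non_amenable Gamma (r : R) (N : nat) (P : X -> X -> Prop) :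
  quasi_lattice Gamma -> 0 < r -> (0 < N)%N ->
  (forall x y, P x y -> mdist x y < r) ->
  (forall x, Gamma x -> exists q : 'I_(2 * N) -> X,
    injective q /\ forall j, Gamma (q j) /\ P x (q j)) ->
  (forall y, ([set x | Gamma x /\ P x y] #<= `I_N)%card) ->
  non_amenable X.
Proof.
move=> qlG r0 N0 Pr desc anc; exists Gamma, 1, r; split=> // F FG finF.
have [_ [Nr lfG]] := qlG.
pose E := \bigcup_(x in F) (Gamma `&` ball x r).
have finE : finite_set E.
  by apply: bigcup_finite => // x _; apply/finite_set_leP; exists (Nr r); exact: lfG.
have finB : finite_set (r_boundary Gamma r F).
  apply: sub_finite_set finE => x [Gx /dist_to_set_lt[a Fa xa] _].
  by exists a => //; split=> //; rewrite ballEmdist /= metric_sym.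
(* A point of [E] outside [F] is within [r] of [F] and itself belongs to [Gamma] minus [F], so it is
   a boundary point. *)
have EF : (fset_set E `<=` fset_set F `|` fset_set (r_boundary Gamma r F))%fset.
  apply/fsubsetP => y; rewrite in_fsetU !in_fset_set// => /set_mem[x Fx [Gy xy]].
  have [Fy|nFy] := pselect (F y); apply/orP; [left|right]; apply/mem_set => //.
  split=> //; apply/dist_to_set_lt.
    by exists x => //; move: xy; rewrite ballEmdist /= metric_sym.
  by exists y => //; rewrite mdistxx.
have cnt : (2 * N * #|` fset_set F| <= N * #|` fset_set E|)%N.
  apply: (double_counting (P := fun x y => `[< P x y >])).
  - move=> x; rewrite in_fset_set// inE => Fx.
    have [q [injq hq]] := desc x (FG _ Fx).
    rewrite -size_filter -[leqLHS]card_ord cardT -(size_map q).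
    apply: uniq_leq_size; first by rewrite map_inj_uniq// enum_uniq.
    move=> _ /mapP[j _ ->]; have [Gq Pq] := hq j.
    rewrite mem_filter in_fset_set// asboolT//= inE; exists x => //.
    by split=> //; rewrite ballEmdist /=; exact: Pr.
  - move=> y _; rewrite -size_filter; apply: card_le_seq (anc y) _ _.
      by rewrite filter_uniq// fset_uniq.
    move=> x; rewrite mem_filter in_fset_set// => /andP[/asboolP Pxy /set_mem Fx].
    by split=> //; exact: FG.
have := fsubset_leq_card EF.
have := cardfsU (fset_set F) (fset_set (r_boundary Gamma r F)).
by rewrite mul1r ler_nat; nia.
Qed.

End QuasiLattices.

Lemma eventually_forall_fin (I : finType) (P : I -> nat -> Prop) :
  (forall i, exists n, forall k, (n <= k)%N -> P i k) ->
  exists n, forall k, (n <= k)%N -> forall i, P i k.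
Proof.
move=> /choice[n hn]; exists (\max_i n i)%N => k nk i.
by apply: hn; apply: leq_trans nk; exact: leq_bigmax.
Qed.

Lemma natr_ge (R : realType) (A : R) : exists n, forall k, (n <= k)%N -> A <= k%:R.
Proof.
exists (Num.truncn A).+1 => k; rewrite -(ler_nat R); apply: le_trans.
exact/ltW/truncnS_gt.
Qed.

(** * Distances and Gromov products along rough rays *)

Section RoughRays.
Context {R : realType} {X : metricType R}.
Variables (mu : R) (o' o : X) (gamma : R -> X).
Hypotheses (mu0 : 0 <= mu) (ray : roughly_geodesic_ray mu gamma).
Hypothesis gamma0 : gamma 0 = o'.
(** The three distances in a Gromov product cost [3 / 2 * mu], which [2 * mu] covers; the other term
    moves the base point from the origin [o'] of the rays to [o]. *)
Let kappa := 2 * mu + mdist o o'.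

Lemma ray_dist t : 0 <= t -> t - kappa <= mdist (gamma t) o <= t + kappa.
Proof.
move=> t0; have := ray t0 (lexx 0); rewrite subr0 (ger0_norm t0) gamma0.
have := metric_triangle (gamma t) o' o; have := metric_triangle (gamma t) o o'.
by rewrite /kappa (metric_sym o' o); move: mu0; lra.
Qed.

Lemma ray_gromov_product s t m : 0 <= s -> 0 <= t -> m <= s -> m <= t ->
  m - kappa <= gromov_product o (gamma s) (gamma t).
Proof.
move=> s0 t0 ms mt; have := gromov_product_base o o' (gamma s) (gamma t).
have := ray t0 (lexx 0); rewrite subr0 (ger0_norm t0) gamma0.
have := ray s0 (lexx 0); rewrite subr0 (ger0_norm s0) gamma0.
have := ray s0 t0; rewrite /gromov_product /kappa.
by case: (lerP s t) => st; move: mu0; lra.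
Qed.

Lemma ray_converges_to_infinity :
  converges_to_infinity o (fun k => gamma k%:R).
Proof.
apply/converges_to_infinityP => A; have [n hn] := natr_ge (A + kappa).
exists n => i j /hn ni /hn nj.
by have := ray_gromov_product (ler0n _ i) (ler0n _ j) ni nj; lra.
Qed.

End RoughRays.

(** * Many separated descendants of every point *)

Section Descendants.
Context {R : realType} {X : metricType R}.
Variables (delta mu : R) (o o' : X) (d : set (nat -> X) -> set (nat -> X) -> R).
Hypotheses (delta0 : 0 <= delta) (mu0 : 0 <= mu).
Hypothesis hyp : forall x y z w : X,
  Num.min (gromov_product w x y) (gromov_product w y z) - delta
    <= gromov_product w x z.
Hypothesis rays : forall x, exists gamma : R -> X,
  [/\ roughly_geodesic_ray mu gamma, gamma 0 = o' &
      exists2 t : R, 0 <= t & gamma t = x].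
Hypothesis hd : visual_metric o d.
Hypothesis hbd :
  finite_union_of_nontrivial_ucc_components d (gromov_boundary o).

(* The order of quantifiers matters: c depends neither on M nor on S. *)
Lemma separated_descendants : exists2 c : R, 0 <= c &
  forall (M : nat) (S : R), (0 < M)%N -> exists2 L : R, 0 <= L &
  forall x, exists y : 'I_M -> X,
    [/\ forall j, mdist x o - c <= gromov_product o x (y j),
        forall j, mdist x o + L - c <= mdist (y j) o <= mdist x o + L + c &
        forall i j, i <> j -> S <= mdist (y i) (y j)].
Proof.
have [dY [eps [c0 [eps0 c01 visd]]]] := hd.
have [D D0 hD] := ucc_separated_points dY hbd.
have c00 : 0 < c0 by lra.
set kappa := 2 * mu + mdist o o'.
have kappa0 : 0 <= kappa.
  by rewrite /kappa; have := mdist_ge0 o o'; move: mu0; lra.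
(* The loss when distance at most [2 * s] on the boundary, with [s] defined below, is turned into a
   Gromov product of sequences: a logarithm from the visual metric and [1 + 2 * delta] from
   [boundary_product_ge]. No [M] enters. *)
set c1 := 1 + 2 * delta + ln (c0 * (2 * D)) / eps.
exists (2 * kappa + `|c1| + 2 * delta).
  by have := normr_ge0 c1; move: delta0; lra.
(* The analogous loss for distance at least [s / M / 2]; it depends on [M] and will be absorbed by
   [L]. *)
move=> M S M0; set c2 := 1 + 2 * delta - ln (D / M%:R / 2 / c0) / eps.
have M0' : 0 < M%:R :> R by rewrite ltr0n.
set L := kappa + `|c2| + 2 * delta + `|S| + 1.
have L0 : 0 <= L.
  by rewrite /L; have := normr_ge0 c2; have := normr_ge0 S; move: delta0; lra.
exists L => // x; set n := mdist x o.
have n0 : 0 <= n by exact: mdist_ge0.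
(* Boundary points at distance about [expR (- (eps * n))] have product about [n]; the factor [D]
   ensures [s <= D]. *)
pose s := D * expR (- (eps * n)).
have s0 : 0 < s by rewrite mulr_gt0// expR_gt0.
have sD : s <= D.
  apply: ler_piMr; first exact: ltW.
  by rewrite -expR0 ler_expR oppr_le0 mulr_ge0// ltW.
have [gamma [ray gamma0 [t0 t00 gx]]] := rays x.
pose u k := gamma k%:R.
have cu : converges_to_infinity o u := ray_converges_to_infinity o mu0 ray gamma0.
have Yxi : gromov_boundary o (class_at_infinity o u) by exists u.
have [|q [Yq qs sepq]] := hD _ s M Yxi _ M0; first by rewrite s0.
have /choice[w hw] : forall j, exists w,
    converges_to_infinity o w /\ class_at_infinity o w = q j.
  by move=> j; have [w cw wq] := Yq j; exists w.
have cw j : converges_to_infinity o (w j) by case: (hw j).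
have wq j : class_at_infinity o (w j) = q j by case: (hw j).
have [k1 hk1] : exists k1, forall k, (k1 <= k)%N -> forall j,
    n - c1 <= gromov_product o (u k) (w j k).
  apply: eventually_forall_fin => j.
  have /andP[visl _] := visd _ _ Yxi (Yq j).
  have h2s : ((d (class_at_infinity o u) (q j))%:E <= (2 * s)%:E)%E.
    by rewrite lee_fin.
  have s20 : 0 < 2 * s by lra.
  have := visual_lower_bound eps0 c00 s20 (le_trans visl h2s).
  have -> : - ln (c0 * (2 * s)) / eps = n - ln (c0 * (2 * D)) / eps.
    rewrite /s !mulrA lnM ?posrE ?expR_gt0 ?mulr_gt0// expRK.
    by rewrite opprD opprK mulrDl [eps * n]mulrC mulfK ?gt_eqF// mulNr addrC.
  rewrite -wq => /(boundary_product_ge hyp delta0)[k hk].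
  by exists k => l /hk; rewrite /c1; lra.
have [k2 hk2] : exists k2, forall k, (k2 <= k)%N -> forall ij : 'I_M * 'I_M,
    ij.1 <> ij.2 -> gromov_product o (w ij.1 k) (w ij.2 k) <= n + c2.
  apply: eventually_forall_fin => -[i j] /=.
  have [->|ij] := eqVneq i j; first by exists 0%N.
  have /andP[_ visu] := visd _ _ (Yq i) (Yq j).
  have hsep : ((s / M%:R / 2)%:E <= (d (q i) (q j))%:E)%E.
    by rewrite lee_fin; apply: sepq; exact/eqP.
  have sM0 : 0 < s / M%:R / 2 by rewrite !divr_gt0.
  have := visual_upper_bound eps0 c00 sM0 (le_trans hsep visu).
  have -> : - ln (s / M%:R / 2 / c0) / eps = n - ln (D / M%:R / 2 / c0) / eps.
    have -> : s / M%:R / 2 / c0 = (D / M%:R / 2 / c0) * expR (- (eps * n)).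
      by rewrite /s; rewrite -!mulrA; congr (_ * _); rewrite mulrC !mulrA.
    rewrite lnM ?posrE ?expR_gt0 ?divr_gt0// expRK.
    by rewrite opprD opprK mulrDl [eps * n]mulrC mulfK ?gt_eqF// mulNr addrC.
  rewrite -!wq => /(boundary_product_le hyp delta0 (cw i) (cw j))[k hk].
  by exists k => l /hk; rewrite /c2; lra.
have [k3 hk3] : exists k3, forall k, (k3 <= k)%N -> forall j,
    n + L + kappa <= mdist (w j k) o.
  apply: eventually_forall_fin => j.
  have /converges_to_infinityP/(_ (n + L + kappa))[k hk] := cw j.
  by exists k => l kl; rewrite -gromov_productxx; exact: hk.
(* Past [k4] the ray through [x] has gone beyond [x], so that the product of [x] and [u k] is almost
   [n]. *)
have [k4 hk4] := natr_ge t0.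
pose k := maxn (maxn k1 k2) (maxn k3 k4).
have [kk1 kk2 kk3 kk4] : [/\ (k1 <= k)%N, (k2 <= k)%N, (k3 <= k)%N & (k4 <= k)%N].
  by split; rewrite !leq_max leqnn ?orbT.
(* A ray through the far point [w j k] stands in for a ray towards the boundary point [q j]; [y j]
   is its point at time [n + L]. By [hk3] the ray reaches [w j k] only after that time. *)
have /choice[y hy] : forall j, exists y,
    n + L - kappa <= gromov_product o (w j k) y /\
    n + L - kappa <= mdist y o <= n + L + kappa.
  move=> j; have [gam [rayj gamj0 [t t'0 gt]]] := rays (w j k).
  have nL0 : 0 <= n + L by lra.
  exists (gam (n + L)); split; last exact: (ray_dist o mu0 rayj gamj0).
  rewrite -gt; apply: (ray_gromov_product o mu0 rayj gamj0) => //.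
  have := ray_dist o mu0 rayj gamj0 t'0; have := hk3 _ kk3 j; rewrite gt.
  by rewrite -/kappa; lra.
have wy j : n + L - kappa <= gromov_product o (w j k) (y j) by case: (hy j).
have ny j : n + L - kappa <= mdist (y j) o <= n + L + kappa by case: (hy j).
have c1n := ler_norm c1; have c2n := ler_norm c2; have Sn := ler_norm S.
have c1p := normr_ge0 c1; have c2p := normr_ge0 c2; have Sp := normr_ge0 S.
have del0 := delta0.
exists y; split.
- move=> j; pose m := n - (2 * kappa + `|c1|).
  have -> : n - (2 * kappa + `|c1| + 2 * delta) = m - 2 * delta by rewrite /m; lra.
  apply: (gromov_product_chain3 hyp delta0 (y := u k) (z := w j k)).
  + have := ray_gromov_product o mu0 ray gamma0 t00 (ler0n _ k) (lexx t0) (hk4 _ kk4).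
    have := ray_dist o mu0 ray gamma0 t00.
    by rewrite gx -/kappa -/n -/(u k) /m; lra.
  + by have := hk1 _ kk1 j; rewrite /m; lra.
  + by have := wy j; rewrite /m; lra.
- by move=> j; have := ny j; lra.
- move=> i j ij.
  (* A larger product would pass along the chain [w i k], [y i], [y j], [w j k] and contradict
     [hk2]; the [1 / 2] makes the contradiction strict. *)
  have yij : gromov_product o (y i) (y j) <= n + c2 + 2 * delta + 1 / 2.
    rewrite leNgt; apply/negP => /ltW yij.
    have wyi : n + c2 + 2 * delta + 1 / 2 <= gromov_product o (w i k) (y i).
      by have := wy i; rewrite /L; lra.
    have wyj : n + c2 + 2 * delta + 1 / 2 <= gromov_product o (y j) (w j k).
      by have := wy j; rewrite gromov_productC /L; lra.
    have := gromov_product_chain3 hyp delta0 wyi yij wyj.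
    by have := hk2 _ kk2 (i, j) ij => /=; lra.
  rewrite (mdist_gromov_product o); have := ny i; have := ny j.
  by rewrite /L; lra.
Qed.

End Descendants.

Theorem theoremB (R : realType) (X : metricType R) (o : X)
    (d : set (nat -> X) -> set (nat -> X) -> R)
    (hproper : uniformly_coarsely_proper X)
    (hvisual : visual X)
    (hhyp : gromov_hyperbolic X)
    (hd : visual_metric o d)
    (hbd : finite_union_of_nontrivial_ucc_components d (gromov_boundary o)) :
  non_amenable X.
Proof.
have [delta delta0 hyp] := hhyp; have [mu [b [mu0 rays]]] := hvisual.
have [c0 c00 desc] := separated_descendants delta0 mu0 hyp rays hd hbd.
have [rho rho0 ulf] := separated_uniformly_locally_finite hproper.
have [Gamma [sepG netG]] := maximal_separated_set (X := X) rho0.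
have [N hN] := ulf _ sepG.
have cobG : cobounded Gamma.
  by exists rho => // x; apply/dist_to_set_lt; exact: netG.
(* Moving a descendant to a point of [Gamma] costs at most [rho] in each estimate. *)
pose c := c0 + rho.
(* The bound on the number of ancestors is fixed before [L], so that [2 * n] descendants can be
   requested; the successor only makes [n] positive. *)
pose n := (N (6 * c + 2 * delta + 1)).+1.
(* Points [2 * rho] apart cannot both be within less than [rho] of the same point of [Gamma], so the
   approximation stays injective. *)
have [L L0 hL] := desc (2 * n)%N (2 * rho) isT.
pose P x y := mdist x o - c <= gromov_product o x y /\
  mdist x o + L - c <= mdist y o <= mdist x o + L + c.
apply: (@expanding_non_amenable _ _ Gamma (L + 3 * c + 1) n P) => //.
- by split=> //; exists N.
- by rewrite /c; lra.
- by move=> x y [Pxy Py]; rewrite (mdist_gromov_product o); lra.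
- move=> x Gx; have [y [xy ny sepy]] := hL x.
  have /choice[g hg] : forall j, exists g, Gamma g /\ mdist (y j) g < rho.
    by move=> j; have [g Gg yg] := netG (y j); exists g.
  exists g; split.
    move=> i j gij; apply: contrapT => ij.
    have [_ yi] := hg i; have [_ yj] := hg j; rewrite gij in yi.
    have := sepy i j ij; have := metric_triangle (y i) (g j) (y j).
    by rewrite (metric_sym (g j)); lra.
  move=> j; have [Gg yg] := hg j; split=> //; split.
    by have := xy j; have := gromov_product_lipschitz o x (y j) (g j); rewrite /c; lra.
  have := ny j; have := metric_triangle (y j) (g j) o.
  have := metric_triangle (g j) (y j) o; rewrite (metric_sym (g j) (y j)).
  by rewrite /c; lra.
- move=> y; have [[x [Gx Px]]|none] := pselect (exists x, Gamma x /\ P x y); last first.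
    rewrite (_ : [set _ | _] = set0) ?card_le0//.
      by apply/seteqP; split=> // x Px; apply: none; exists x.
  have r0 : 0 < 6 * c + 2 * delta + 1 by rewrite /c; lra.
  (* All ancestors of [y] lie near any one of them, [x]: their distances to [o] are at most
     [mdist y o - L + c], and their mutual products at least [mdist y o - L - 2 * c - delta]. In the
     resulting distance bound [6 * c + 2 * delta] the terms in [L] cancel. *)
  apply: (@card_le_trans _ _ _ (Gamma `&` ball x (6 * c + 2 * delta + 1))).
    apply: subset_card_le => x' [Gx' Px']; split=> //; rewrite ballEmdist /=.
    have [xy nx] := Px; have [x'y nx'] := Px'.
    have mx : mdist y o - L - 2 * c <= gromov_product o x y by lra.
    have mx' : mdist y o - L - 2 * c <= gromov_product o y x'.
      by rewrite gromov_productC; lra.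
    rewrite (mdist_gromov_product o).
    by have := gromov_product_chain2 hyp mx mx'; lra.
  by apply: card_le_trans (hN _ x r0) _; rewrite card_le_II.
Qed.
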